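(* Let $B(F)$ be a stationary generalized Bratteli diagram and $A=F^T$. Suppose that $A$ is irreducible, aperiodic, and positive recurrent. Let $\lambda$ be the Perron eigenvalue of $A$ and let $\xi=(\xi_i)$, $\eta=(\eta_i)$ be the corresponding (positive) right and left eigenvectors, $A\xi=\lambda\xi$, $\eta A=\lambda\eta$, normalized such that $\sum_{v\in V_0}\xi_v=1$ and $\eta\cdot\xi=\sum_v\eta_v\xi_v=1$. Then, for every $v,w\in V_0$, $$\frac{H^{(n)}_w}{H^{(n+1)}_v}\longrightarrow\frac{\eta_w}{\lambda\,\eta_v}\qquad\text{as } n\to\infty .$$
   Context: The stationary generalized Bratteli diagram $B(F)$ has all vertex levels $V_n$, $n\ge0$, identified with one countably infinite set $V_0$ ($\mathbb N$ or $\mathbb Z$), and for every $n\ge0$ exactly $f_{v,w}\in\{0,1,2,\dots\}$ edges from $w\in V_n$ to $v\in V_{n+1}$, where $F=(f_{v,w})$; every row of $F$ has finitely many nonzero entries and no row or column of $F$ is zero. $H^{(n)}_v$ is the number of all finite paths from $V_0$ to $v\in V_n$, with $H^{(0)}_v=1$; thus $H^{(n+1)}=FH^{(n)}$. For a non-negative infinite matrix $A$, $A^n=(a^{(n)}_{ij})$: $A$ is irreducible if for all $i,j$ there is $n>0$ with $a^{(n)}_{ij}>0$; aperiodic if moreover $\gcd\{n:a^{(n)}_{ii}>0\}=1$. The Perron eigenvalue is $\lambda=\lim_n (a^{(n)}_{ii})^{1/n}$ (independent of $i$), assumed finite. $A$ is recurrent if $\sum_{n\ge0}a^{(n)}_{ii}\lambda^{-n}=\infty$.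 Put $l_{w,v}(1)=a_{w,v}$, $l_{w,v}(n+1)=\sum_{i\ne w}l_{w,i}(n)a_{i,v}$; a recurrent $A$ is positive recurrent if $\sum_{n\ge1}n\,l_{w,w}(n)\lambda^{-n}<\infty$. A recurrent $A$ has strictly positive right and left eigenvectors for $\lambda$, unique up to constant multiples. *)

(* Defs.v *)
From HB Require Import structures.
From mathcomp Require Import all_boot all_order all_algebra.
From mathcomp Require Import finmap.
From mathcomp Require Import all_classical all_reals all_analysis.

Set Implicit Arguments.
Unset Strict Implicit.
Unset Printing Implicit Defensive.

Import Order.TTheory GRing.Theory Num.Theory.
Import numFieldNormedType.Exports.

Local Open Scope classical_set_scope.
Local Open Scope ring_scope.

(* [F v w] is the number of edges from [w] (level n) to [v] (level n + 1), the
   same for all n; every level is identified with [V]. *)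
Definition stationary_bratteli (V : countType) (F : V -> V -> nat) : Prop :=
  [/\ infinite_set [set: V],
      forall v, finite_set [set w | F v w != 0%N],
      forall v, exists w, F v w != 0%N &
      forall w, exists v, F v w != 0%N].

(* An edge from [w] to [v] is encoded as [(w, v, k)] with [k < F v w]. *)
Notation edge V := (V * V * nat)%type.

Fixpoint is_walk (V : countType) (F : V -> V -> nat)
    (x : V) (es : seq (edge V)) (v : V) : bool :=
  if es is (s, t, k) :: es' then
    [&& s == x, (k < F t s)%N & is_walk F t es' v]
  else x == v.

(* A path is its initial vertex at level 0 followed by its edges; keeping the
   initial vertex makes sense of paths without edges. *)
Definition finite_paths (V : countType) (F : V -> V -> nat) (n : nat) (v : V) :
    set (V * seq (edge V)) :=
  [set p | size p.2 = n /\ is_walk F p.1 p.2 v].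

(* Row-finiteness of [F] makes [finite_paths F n v] finite, so that its
   cardinal is not the junk value of [fset_set]. *)
Definition height (V : countType) (F : V -> V -> nat) (n : nat) (v : V) : nat :=
  #|` fset_set (finite_paths F n v)|.

Definition tr_incidence (R : realType) (V : countType) (F : V -> V -> nat) :
    V -> V -> R :=
  fun v w => (F w v)%:R.

Section InfiniteMatrices.
Context {R : realType} {V : countType}.
Implicit Types (A : V -> V -> R) (lam : R) (xi eta : V -> R).

Local Open Scope ereal_scope.

(* These notions are meant for non-negative matrices and vectors, so that all
   sums are unconditional sums of non-negative terms, valued in [0, +oo]. *)

Fixpoint mxpow A (n : nat) (i j : V) : \bar R :=
  if n is m.+1 then \esum_(k in [set: V]) (mxpow A m i k * (A k j)%:E)
  else ((i == j)%:R)%:E.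

Definition irreducible_mx A : Prop :=
  forall i j, exists n, (0 < n)%N /\ 0 < mxpow A n i j.

Definition is_gcd_of (S : set nat) (g : nat) : Prop :=
  (forall n, S n -> (g %| n)%N) /\
  (forall d, (forall n, S n -> (d %| n)%N) -> (d %| g)%N).

Definition aperiodic_mx A : Prop :=
  irreducible_mx A /\
  forall i, is_gcd_of [set n | 0 < mxpow A n i i] 1%N.

Definition perron_eigenvalue A lam : Prop :=
  forall i, (mxpow A n i i `^ (n%:R^-1)%R) @[n --> \oo] --> lam%:E.

Definition recurrent_mx A lam : Prop :=
  forall i, \sum_(0 <= n <oo) (mxpow A n i i * (lam ^- n)%:E) = +oo.

(* [first_return A w n v] is l_{w,v}(n) for n >= 1; the value at 0 is unused. *)
Fixpoint first_return A (w : V) (n : nat) (v : V) : \bar R :=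
  match n with
  | 0%N => 0
  | 1%N => (A w v)%:E
  | m.+1 => \esum_(i in [set i | i != w]) (first_return A w m i * (A i v)%:E)
  end.

Definition positive_recurrent_mx A lam : Prop :=
  recurrent_mx A lam /\
  forall w, \sum_(1 <= n <oo)
    ((n%:R)%:E * first_return A w n w * (lam ^- n)%:E) < +oo.

Definition right_eigenvector A lam xi : Prop :=
  forall i, \esum_(j in [set: V]) (A i j * xi j)%:E = (lam * xi i)%:E.

Definition left_eigenvector A lam eta : Prop :=
  forall j, \esum_(i in [set: V]) (eta i * A i j)%:E = (lam * eta j)%:E.

End InfiniteMatrices.

(* Main.v *)
Require Import Defs.
From HB Require Import structures.
From mathcomp Require Import all_boot all_order all_algebra.
From mathcomp Require Import finmap.
From mathcomp Require Import all_classical all_reals all_analysis.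
From mathcomp Require Import ring lra.

(** Write h n w for the height of w at level n. The claim follows from
    h n w / lam ^+ n --> eta w ([height_asymptotics]).

    Normalize: g n w = h n w / (lam ^+ n * eta w). As h (n+1) = F h n and
    eta is a left eigenvector of the transpose of F, the functions g n are the
    iterates, from g 0 = 1 / eta, of the averaging operator of a Markov chain
    whose transition weight from w to u is F w u * eta u / (lam * eta w). Its rows
    are finite, and since xi is a right eigenvector the weights
    mu v = eta v * xi v form a stationary probability. The mu-mean of g 0 is
    the sum of xi, which is 1. So the claim is that the iterates of an integrable
    function under an irreducible aperiodic chain with a stationary probability
    converge pointwise to its mean ([markov_op_cvg]).

    For a bounded starting function this is an energy argument. The mu-mean of
    the square of g n decreases by the mean of the row variances, so these
    variances tend to 0, and g n u - g (n+1) w --> 0 whenever the chain can step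
    from w to u ([markov_op_lag]). Along paths such asymptotic equalities compose
    and shift time. The time shifts under which the values at one vertex are
    asymptotically invariant form a group of integers that contains the lengths
    of all closed paths, hence the shift 1; so g n u - g n w --> 0 for all u and w
    ([aperiodic_synchronization]). Since the mean of g n stays constant, its
    values converge to it ([bounded_synchronized_cvg]). An unbounded starting
    function is cut off outside a finite set, at the cost of an error that is
    small in mean, and therefore small at each given vertex at all times. *)

Set Implicit Arguments.
Unset Strict Implicit.
Unset Printing Implicit Defensive.

Import Order.TTheory GRing.Theory Num.Theory.
Import numFieldNormedType.Exports.

Local Open Scope classical_set_scope.
Local Open Scope ring_scope.

(** * Convergent sums of non-negative families *)

Section NonnegativeSums.
Context {R : realType} {V : choiceType}.
Implicit Types (f g : V -> R) (a b c k : R).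

(** Relating the family to a real value, instead of naming an extended real sum,
    keeps all later arguments in ordered-field arithmetic. *)
Definition has_nnsum f c : Prop :=
  (forall v, 0 <= f v) /\ (\esum_(v in [set: V]) (f v)%:E = c%:E)%E.

Lemma has_nnsum_ge0 f c : has_nnsum f c -> 0 <= c.
Proof.
move=> [f0 fc]; rewrite -lee_fin -fc.
by apply: esum_ge0 => v _; rewrite lee_fin.
Qed.

Lemma eq_has_nnsum f g c : f =1 g -> has_nnsum f c -> has_nnsum g c.
Proof. by move=> /funext ->. Qed.

Lemma has_nnsumD f g a b :
  has_nnsum f a -> has_nnsum g b -> has_nnsum (f \+ g) (a + b).
Proof.
move=> [f0 fa] [g0 gb]; split=> [v|]; first exact: addr_ge0.
by rewrite EFinD -fa -gb -esumD// => v _; rewrite lee_fin.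
Qed.

Lemma has_nnsumB f g a c :
  has_nnsum f a -> has_nnsum (f \+ g) c -> (forall v, 0 <= g v) ->
  has_nnsum g (c - a).
Proof.
move=> [f0 fa] [_ fgc] g0; split=> //; rewrite EFinB -fgc -fa.
rewrite (_ : \esum_(v in _) ((f \+ g) v)%:E =
  \esum_(v in [set: V]) (f v)%:E + \esum_(v in [set: V]) (g v)%:E)%E.
  by rewrite fa addeAC subee// add0e.
by rewrite -esumD// => v _; rewrite lee_fin.
Qed.

Lemma has_nnsum_dom f g b :
  has_nnsum g b -> (forall v, 0 <= f v <= g v) -> exists a, has_nnsum f a.
Proof.
move=> [_ gb] fg; have f0 v : 0 <= f v by case/andP: (fg v).
exists (fine (\esum_(v in [set: V]) (f v)%:E)%E); split=> //.
rewrite fineK// ge0_fin_numE; last by apply: esum_ge0 => v _; rewrite lee_fin.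
apply: (@le_lt_trans _ _ b%:E); last exact: ltry.
by rewrite -gb; apply: le_esum => v _; rewrite lee_fin; case/andP: (fg v).
Qed.

Lemma esum_finite_support f (s : seq V) : uniq s ->
  (forall v, 0 <= f v) -> (forall v, v \notin s -> f v = 0) ->
  (\esum_(v in [set: V]) (f v)%:E = (\sum_(v <- s) f v)%:E)%E.
Proof.
move=> us f0 fs.
transitivity (\esum_(v in [set` s]) (f v)%:E)%E.
  rewrite [RHS]esum_mkcond; apply: eq_esum => v _; rewrite mem_setE.
  by case: ifPn => // /fs ->.
rewrite esum_fset; [|exact: finite_seq|by move=> v _; rewrite lee_fin].
by rewrite -fsbig_seq// sumEFin.
Qed.

Lemma has_nnsum_seq f (s : seq V) : uniq s ->
  (forall v, 0 <= f v) -> (forall v, v \notin s -> f v = 0) ->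
  has_nnsum f (\sum_(v <- s) f v).
Proof. by move=> us f0 fs; split=> //; exact: esum_finite_support. Qed.

Lemma has_nnsum_ub f c (s : seq V) :
  has_nnsum f c -> uniq s -> \sum_(v <- s) f v <= c.
Proof.
move=> [f0 fc] us; rewrite -lee_fin -fc esum_ge//.
exists [set` s]; first by split=> //; exact: finite_seq.
by rewrite -fsbig_seq// sumEFin.
Qed.

Lemma has_nnsum_term f c v : has_nnsum f c -> f v <= c.
Proof. by move=> /has_nnsum_ub - /(_ [:: v] isT); rewrite big_seq1. Qed.

Lemma has_nnsum_adherent f c e : has_nnsum f c -> 0 < e ->
  exists2 s : seq V, uniq s & c - e < \sum_(v <- s) f v.
Proof.
move=> [f0 fc] e0.
have : ((c - e)%:E < \esum_(v in [set: V]) (f v)%:E)%E.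
  by rewrite fc lte_fin ltrBlDr ltrDl.
case/ereal_sup_gt => _ [A [finA _] <-] lt_A.
exists (enum_fset (fset_set A)); first exact: fset_uniq.
by move: lt_A; rewrite fsbig_finite//= sumEFin lte_fin.
Qed.

(** The upper bound holds on finite subfamilies; for the lower bound, a finite
    subfamily that almost exhausts the sum of [f] almost exhausts the scaled
    one. *)
Lemma has_nnsumZ f c k : 0 <= k -> has_nnsum f c ->
  has_nnsum (fun v => k * f v) (k * c).
Proof.
move=> k0 fc; have [f0 _] := fc.
have kf0 v : 0 <= k * f v by exact: mulr_ge0.
split=> //; apply/eqP; rewrite eq_le; apply/andP; split.
  apply: ge_ereal_sup => _ [A [finA _] <-].
  rewrite fsbig_finite//= sumEFin lee_fin -mulr_sumr ler_wpM2l//.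
  by apply: has_nnsum_ub fc _; exact: fset_uniq.
apply/lee_addgt0Pr => e e0.
(* Dividing by k + 1 rather than k also covers k = 0. *)
have k1 : 0 < k + 1 by rewrite ltr_wpDl.
have [s us lt_s] := has_nnsum_adherent fc (divr_gt0 e0 k1).
apply: (@le_trans _ _ ((\sum_(v <- s) k * f v)%:E + e%:E)%E); last first.
  rewrite leeD2r// esum_ge//; exists [set` s].
    by split=> //; exact: finite_seq.
  by rewrite -fsbig_seq// sumEFin.
rewrite -EFinD lee_fin -mulr_sumr -lerBlDr.
apply: (@le_trans _ _ (k * (c - e / (k + 1)))); last by rewrite ler_wpM2l// ltW.
have : k * (e / (k + 1)) <= e.
  by rewrite mulrCA ler_piMr ?ltW// ltr_pdivrMr// mul1r ltrDl.
by rewrite mulrBr; lra.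
Qed.

End NonnegativeSums.

(** Tonelli: both iterated sums are the sum over pairs, up to transposition. *)
Lemma esum_swap {R : realType} {V W : choiceType} (a : V -> W -> \bar R) :
  (forall v w, 0 <= a v w)%E ->
  (\esum_(v in [set: V]) \esum_(w in [set: W]) a v w =
   \esum_(w in [set: W]) \esum_(v in [set: V]) a v w)%E.
Proof.
move=> a0; rewrite !esum_esum//.
rewrite (@reindex_esum _ _ _ ([set: W] `*`` (fun=> [set: V])) _
  (fun p : W * V => (p.2, p.1)))//.
split=> [[w v]//|[w v] [w' v'] _ _ [-> ->]//|[v w] _].
by exists (w, v).
Qed.

(** * Synchronization along an aperiodic graph *)

Section Synchronization.
Context {R : realType} {V : countType}.
Implicit Types (A : V -> V -> R) (g : nat -> V -> R) (u v w : V).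

Lemma mxpow_ge0 A n i j : (forall i j, 0 <= A i j) -> (0 <= mxpow A n i j)%E.
Proof.
move=> A0; elim: n j => [|n IH] j /=; first by rewrite lee_fin ler0n.
by apply: esum_ge0 => k _; rewrite mule_ge0// lee_fin.
Qed.

Lemma mxpowS_gt0 A n i j : (forall i j, 0 <= A i j) ->
  (0 < mxpow A n.+1 i j)%E -> exists2 k, (0 < mxpow A n i k)%E & 0 < A k j.
Proof.
move=> A0 /=; apply: contraPP => noK; apply/negP; rewrite -leNgt esum1// => k _.
have [->|/eqP mk] := eqVneq (mxpow A n i k) 0%E; first by rewrite mul0e.
have [->|/eqP ak] := eqVneq (A k j) 0; first by rewrite mule0.
case: noK; exists k; last by rewrite lt_neqAle A0 andbT eq_sym; apply/eqP.
by rewrite lt_neqAle mxpow_ge0// andbT eq_sym; apply/eqP.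
Qed.

(** Lags add up along paths ([lag_trans]). Negative lags are never named:
    [lag_cancel] stands for composing with one of them. For fixed [g] and [u] the
    lags of [u] to itself thus behave as the non-negative part of a subgroup of
    the integers. *)
Definition lag g u w n : Prop := (g m u - g (m + n)%N w) @[m --> \oo] --> 0.

Lemma lag_shift g u v m n : lag g u v n ->
  (g (k + m)%N u - g (k + (m + n))%N v) @[k --> \oo] --> 0.
Proof.
move=> uv; under eq_fun do rewrite addnA.
exact: cvg_comp (cvg_addnr m) uv.
Qed.

Lemma lag_trans g u v w m n : lag g u v m -> lag g v w n -> lag g u w (m + n).
Proof.
move=> uv /(lag_shift m) vw; rewrite /lag -(addr0 0).
have E k : g k u - g (k + (m + n))%N w =
    (g k u - g (k + m)%N v) + (g (k + m)%N v - g (k + (m + n))%N w) by ring.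
by under eq_fun do rewrite E; apply: cvgD.
Qed.

Lemma lag_cancel g u v w m n :
  lag g u w (m + n) -> lag g v w n -> lag g u v m.
Proof.
move=> uw /(lag_shift m) vw; rewrite /lag -(subr0 0).
have E k : g k u - g (k + m)%N v =
    (g k u - g (k + (m + n))%N w) - (g (k + m)%N v - g (k + (m + n))%N w).
  by ring.
by under eq_fun do rewrite E; apply: cvgB.
Qed.

Lemma lag_refl g u : lag g u u 0.
Proof.
rewrite /lag; under eq_fun do rewrite addn0 subrr.
exact: cvg_cst.
Qed.

Lemma lag_mul g u q n : lag g u u n -> lag g u u (q * n).
Proof.
move=> un; elim: q => [|q IH]; first by rewrite mul0n; exact: lag_refl.
by rewrite mulSn; exact: lag_trans IH.
Qed.

(** The self-lags are the non-negative part of a subgroup of the integers, hence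
    the multiples of the least positive one [d]: the remainder of a self-lag
    modulo [d] is again a self-lag by cancellation, so it vanishes. If no number
    other than 1 divides them all, then [d = 1]. *)
Lemma lag_gcd g u : (exists2 n, (0 < n)%N & lag g u u n) ->
  (forall d, (forall n, lag g u u n -> (d %| n)%N) -> d = 1%N) ->
  lag g u u 1.
Proof.
move=> [n n0 un] gcd1.
have exP : exists n, (0 < n)%N && `[< lag g u u n >].
  by exists n; rewrite n0; apply/asboolP.
case: (ex_minnP exP) => d /andP[d0 /asboolP ud] dmin.
rewrite -(gcd1 d)// => m um; rewrite /dvdn -leqn0 leqNgt; apply/negP => r0.
have /dmin : (0 < m %% d)%N && `[< lag g u u (m %% d) >].
  rewrite r0; apply/asboolP; apply: (@lag_cancel _ _ _ u _ (m %/ d * d)).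
    by rewrite addnC -divn_eq.
  exact: lag_mul.
by rewrite leqNgt ltn_mod d0.
Qed.

Lemma mxpow_lag A g n u w : (forall i j, 0 <= A i j) ->
  (forall i j, 0 < A i j -> lag g i j 1) ->
  (0 < mxpow A n u w)%E -> lag g u w n.
Proof.
move=> A0 edge; elim: n w => [|n IH] w.
  rewrite /= lte_fin ltr0n lt0b => /eqP ->; exact: lag_refl.
move=> /(mxpowS_gt0 A0)[k /IH uk /edge kw].
by rewrite -addn1; exact: lag_trans kw.
Qed.

(** Return times are self-lags, so aperiodicity puts the lag 1, and then every
    lag, between a vertex and itself. A path from [u] to [w] gives some lag
    between them, and a self-lag of [w] of the same length cancels it. *)
Theorem aperiodic_synchronization A g : (forall i j, 0 <= A i j) ->
  aperiodic_mx A -> (forall i j, 0 < A i j -> lag g i j 1) ->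
  forall u w, lag g u w 0.
Proof.
move=> A0 [irr aper] edge u w.
have toN n := @mxpow_lag A g n _ _ A0 edge.
have [n [n0 /toN uw]] := irr u w.
have ww : lag g w w 1.
  apply: lag_gcd => [|d dvd].
    by have [m [m0 /toN]] := irr w w; exists m.
  have [_ /(_ d)] := aper w; rewrite dvdn1 => /(_ _)/eqP -> // m /toN.
  exact: dvd.
apply: (@lag_cancel _ _ _ w _ n); first by rewrite add0n.
by rewrite -[n]muln1; exact: lag_mul.
Qed.

End Synchronization.

(** * Convergence to the mean for a Markov operator with finite rows *)

Section MarkovOperator.
Context {R : realType} {V : countType}.
Context (K : V -> V -> R) (N : V -> seq V) (mu : V -> R).
Context (N_uniq : forall w, uniq (N w))
  (K_ge0 : forall w u, 0 <= K w u)
  (K_out : forall w u, u \notin N w -> K w u = 0)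
  (K_stoch : forall w, \sum_(u <- N w) K w u = 1)
  (mu_gt0 : forall w, 0 < mu w)
  (mu_sum : has_nnsum mu 1)
  (mu_stat : forall u, has_nnsum (fun w => mu w * K w u) (mu u)).
Implicit Types (f g : V -> R) (u w : V).

Definition markov_op f w : R := \sum_(u <- N w) K w u * f u.

Definition mean f c : Prop := has_nnsum (fun w => mu w * f w) c.

Lemma markov_op_ge0 f : (forall v, 0 <= f v) -> forall w, 0 <= markov_op f w.
Proof. by move=> f0 w; apply: sumr_ge0 => u _; exact: mulr_ge0. Qed.

Lemma markov_op_le f M : (forall v, f v <= M) -> forall w, markov_op f w <= M.
Proof.
move=> fM w; rewrite -[leRHS]mul1r -(K_stoch w) mulr_suml.
by apply: ler_sum => u _; exact: ler_wpM2l.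
Qed.

Lemma markov_opD f g : markov_op (f \+ g) = markov_op f \+ markov_op g.
Proof.
apply/funext => w; rewrite /markov_op /= -big_split /=.
by apply: eq_bigr => u _; rewrite mulrDr.
Qed.

Lemma iter_markov_opD n f g :
  iter n markov_op (f \+ g) = iter n markov_op f \+ iter n markov_op g.
Proof. by elim: n => //= n ->; rewrite markov_opD. Qed.

Lemma iter_markov_op_ge0 n f :
  (forall v, 0 <= f v) -> forall w, 0 <= iter n markov_op f w.
Proof. by move=> f0; elim: n => //= n IH; exact: markov_op_ge0. Qed.

Lemma iter_markov_op_le n f M :
  (forall v, f v <= M) -> forall w, iter n markov_op f w <= M.
Proof. by move=> fM; elim: n => //= n IH; exact: markov_op_le. Qed.

(** Stationarity of [mu] in integrated form, by exchanging the two sums. *)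
Lemma mean_markov_op f c :
  (forall v, 0 <= f v) -> mean f c -> mean (markov_op f) c.
Proof.
move=> f0 [_ fc]; split=> [w|].
  by rewrite mulr_ge0// ?markov_op_ge0// ltW.
have t0 w u : 0 <= mu w * (K w u * f u) by rewrite !mulr_ge0// ltW.
transitivity (\esum_(w in [set: V]) \esum_(u in [set: V])
    (mu w * (K w u * f u))%:E)%E.
  apply: eq_esum => w _; rewrite (@esum_finite_support _ _ _ (N w))//.
    by rewrite /markov_op mulr_sumr.
  by move=> u /K_out ->; rewrite mul0r mulr0.
rewrite esum_swap; last by move=> *; rewrite lee_fin.
rewrite -fc; apply: eq_esum => u _.
have [_] := has_nnsumZ (f0 u) (mu_stat u); rewrite [mu u * _]mulrC => <-.
by apply: eq_esum => w _; congr (_%:E); ring.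
Qed.

Lemma mean_iter_markov_op n f c :
  (forall v, 0 <= f v) -> mean f c -> mean (iter n markov_op f) c.
Proof.
move=> f0 fc; elim: n => //= n IH; apply: mean_markov_op IH.
exact: iter_markov_op_ge0.
Qed.

(** Jensen's inequality for the square, with its defect kept: the defect is the
    quantity that [markov_op_lag] makes tend to 0. *)
Lemma markov_op_variance f w :
  markov_op (fun v => f v ^+ 2) w =
  markov_op f w ^+ 2 + \sum_(u <- N w) K w u * (f u - markov_op f w) ^+ 2.
Proof.
set m := markov_op f w.
have -> : \sum_(u <- N w) K w u * (f u - m) ^+ 2 =
    \sum_(u <- N w) (K w u * f u ^+ 2 - 2 * m * (K w u * f u) + m ^+ 2 * K w u).
  by apply: eq_bigr => u _; ring.
rewrite !big_split /= sumrN -!mulr_sumr K_stoch -/(markov_op f w) -/m.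
by rewrite /markov_op; ring.
Qed.

(** With [V] empty, the bounds on [f] carry no information on the sign of [M];
    this case is split off. *)
Lemma mean_bounded f M : (forall v, 0 <= f v <= M) -> exists c, mean f c.
Proof.
move=> fM; case: (pselect (exists v : V, True)) => [[v0 _]|noV]; last first.
  by exists 0; split=> [v|]; [|rewrite esum1// => v]; case: noV; exists v.
have M0 : 0 <= M by have /andP[] := fM v0; exact: le_trans.
apply: (has_nnsum_dom (has_nnsumZ M0 mu_sum)) => v.
have /andP[f0 fM'] := fM v.
by rewrite mulr_ge0 ?(ltW (mu_gt0 v))//= mulrC ler_wpM2r// ltW.
Qed.

(** Energy argument. By stationarity and the variance identity, one application
    of the operator lowers the [mu]-mean of the squared function by the [mu]-mean
    of the row variances. The energies are non-negative, so they converge and the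
    variances tend to 0; as all weights are positive, each term of each row
    variance tends to 0, in particular the one of the pair [(w, u)]. *)
Lemma markov_op_lag f M u w : (forall v, 0 <= f v <= M) -> 0 < K w u ->
  lag (fun n => iter n markov_op f) u w 1.
Proof.
move=> fM Kwu; pose g n := iter n markov_op f.
have gM n v : 0 <= g n v <= M.
  rewrite iter_markov_op_ge0 ?iter_markov_op_le// => x.
    by have /andP[] := fM x.
  by have /andP[] := fM x.
have g2M n v : 0 <= g n v ^+ 2 <= M ^+ 2.
  have /andP[g0 gleM] := gM n v.
  by rewrite sqr_ge0 lerXn2r// nnegrE// (le_trans g0).
have /choice[e he] n := mean_bounded (g2M n).
have drop n : mu w * (K w u * (g n u - g n.+1 w) ^+ 2) <= e n - e n.+1.
  pose var v := \sum_(x <- N v) K v x * (g n x - g n.+1 v) ^+ 2.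
  have var0 v : 0 <= var v.
    by apply: sumr_ge0 => x _; rewrite mulr_ge0// sqr_ge0.
  have hvar : mean var (e n - e n.+1).
    apply: (has_nnsumB (he n.+1)); last first.
      by move=> v; rewrite mulr_ge0// ltW.
    have := mean_markov_op (fun v => sqr_ge0 (g n v)) (he n).
    by apply: eq_has_nnsum => v /=; rewrite markov_op_variance mulrDr.
  apply: le_trans (has_nnsum_term w hvar).
  rewrite ler_wpM2l ?(ltW (mu_gt0 w))//.
  have uN : u \in N w by apply: contraTT Kwu => /K_out ->; rewrite ltxx.
  rewrite /var (bigD1_seq u)//= lerDl.
  by apply: sumr_ge0 => x _; rewrite mulr_ge0// sqr_ge0.
have k0 : 0 < mu w * K w u by exact: mulr_gt0.
have e_cvg : cvgn e.
  apply: nonincreasing_is_cvgn.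
    apply/nonincreasing_seqP => n; rewrite -subr_ge0; apply: le_trans (drop n).
    by rewrite mulr_ge0 ?(ltW (mu_gt0 w))// mulr_ge0// sqr_ge0.
  exists 0 => _ [n _ <-]; exact: has_nnsum_ge0 (he n).
have de0 : (mu w * K w u)^-1 * (e n - e n.+1) @[n --> \oo] --> 0.
  rewrite -[X in _ --> X](mulr0 (mu w * K w u)^-1) -(subrr (limn e)).
  by apply: cvgMl_tmp; apply: cvgB => //; rewrite cvg_shiftS.
have sq0 : (g n u - g n.+1 w) ^+ 2 @[n --> \oo] --> 0.
  apply: squeeze_cvgr (cvg_cst 0) de0; apply: nearW => n.
  by rewrite sqr_ge0/= ler_pdivlMl// -mulrA.
rewrite /lag; under eq_fun do rewrite addn1.
apply/cvgr0Pnorm_lt => d d0.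
move/cvgr0Pnorm_lt: sq0 => /(_ _ (exprn_gt0 2 d0)); apply: filterS => n.
by rewrite normrX ltr_pXn2r// nnegrE// ltW.
Qed.

(** On a finite set carrying almost all the mass, every value of [g n] is close
    to [g n w], and the partial mean over that set is at most [c]; the rest of the
    mass contributes at most its weight times [M]. *)
Lemma synchronized_mean_le (g : nat -> V -> R) c M :
  (forall n v, 0 <= g n v <= M) -> (forall n, mean (g n) c) ->
  (forall u w, lag g u w 0) ->
  forall w (e : R), 0 < e -> \forall n \near \oo, g n w <= c + e.
Proof.
move=> gM gc sync w e e0.
have M1 : 0 < M + 1.
  by have /andP[g0 gleM] := gM 0%N w; rewrite ltr_wpDl// (le_trans g0).
(* The mass left outside s is below (e / 2) / (M + 1), so that the tail below
   is at most e / 2. *)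
have e2 : 0 < e / 2 by rewrite divr_gt0.
have [s us lt_s] := has_nnsum_adherent mu_sum (divr_gt0 e2 M1).
have : \sum_(u <- s) mu u * (g n w - g n u) @[n --> \oo] --> 0.
  elim: s {us lt_s} => [|u s IH].
    by under eq_fun do rewrite big_nil; exact: cvg_cst.
  rewrite -[X in _ --> X]addr0; under eq_fun do rewrite big_cons.
  apply: cvgD IH; rewrite -[X in _ --> X](mulr0 (mu u)); apply: cvgMl_tmp.
  by have := sync w u; rewrite /lag; under eq_fun do rewrite addn0.
move=> /cvgr0Pnorm_lt/(_ _ e2); apply: filterS => n.
move=> /ltr_normlW diff_lt.
have /andP[g0 gleM] := gM n w.
have mass_le1 := has_nnsum_ub mu_sum us.
have part_le := has_nnsum_ub (gc n) us.
have split_g : g n w = \sum_(u <- s) mu u * g n u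
    + \sum_(u <- s) mu u * (g n w - g n u) + (1 - \sum_(u <- s) mu u) * g n w.
  under [X in _ = _ + X + _]eq_bigr do rewrite mulrBr.
  by rewrite big_split/= sumrN -mulr_suml; ring.
have tail : (1 - \sum_(u <- s) mu u) * g n w <= e / 2.
  apply: (@le_trans _ _ (e / 2 / (M + 1) * (M + 1))).
    apply: ler_pM => //; lra.
  by rewrite divfK// gt_eqF.
lra.
Qed.

(** The lower bound is the upper bound of [synchronized_mean_le] for [M - g]. *)
Lemma bounded_synchronized_cvg (g : nat -> V -> R) c M :
  (forall n v, 0 <= g n v <= M) -> (forall n, mean (g n) c) ->
  (forall u w, lag g u w 0) ->
  forall w, g n w @[n --> \oo] --> c.
Proof.
move=> gM gc sync w; apply/cvgrPdist_le => e e0.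
have up := synchronized_mean_le gM gc sync w e0.
have lo : \forall n \near \oo, M - g n w <= (M - c) + e.
  apply: (@synchronized_mean_le (fun n v => M - g n v) (M - c) M) => //.
  - move=> n v; have /andP[] := gM n v.
    by rewrite subr_ge0 lerBlDr lerDl => -> ->.
  - move=> n; apply: (has_nnsumB (gc n)); last first.
      move=> v; rewrite mulr_ge0 ?(ltW (mu_gt0 v))//.
      by have /andP[] := gM n v; rewrite subr_ge0.
    have M0 : 0 <= M by have /andP[g0] := gM 0%N w; exact: le_trans.
    rewrite -[M in has_nnsum _ M]mulr1; have := has_nnsumZ M0 mu_sum.
    by apply: eq_has_nnsum => v /=; ring.
  - move=> u v; have := sync v u; rewrite /lag.
    under eq_fun do rewrite addn0.
    have E n : M - g n u - (M - g (n + 0)%N v) = g n v - g n u.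
      by rewrite addn0; ring.
    by under [in X in _ -> X]eq_fun do rewrite E.
near=> n.
have h1 : g n w <= c + e by near: n.
have h2 : M - g n w <= M - c + e by near: n.
by rewrite ler_norml; apply/andP; split; lra.
Unshelve. all: by end_near. Qed.

(** For bounded [f] this combines the energy argument, synchronization and the
    preservation of means. In general [f] may be unbounded: split it into its
    restriction [a] to a large finite set, which is bounded, and a rest [b] of
    small mean. The iterates of [b] keep that small mean, and a function of small
    mean is small at [w], since [mu w] is a fixed positive number. The matrix [A]
    marks positions where [K] is positive, in the transposed order in which the
    walks of a diagram are read. *)
Theorem markov_op_cvg (A : V -> V -> R) f c :
  (forall i j, 0 <= A i j) -> aperiodic_mx A ->
  (forall i j, 0 < A i j -> 0 < K j i) ->
  (forall v, 0 <= f v) -> mean f c ->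
  forall w, iter n markov_op f w @[n --> \oo] --> c.
Proof.
move=> A0 aper suppA f0 fc w; apply/cvgrPdist_le => e e0.
have mu_le1 : mu w <= 1 := has_nnsum_term w mu_sum.
have e3 : 0 < e / 3 by rewrite divr_gt0.
(* The factor mu w turns a mean below (e / 3) * mu w into a value below e / 3
   at w. *)
have [s us lt_s] := has_nnsum_adherent fc (mulr_gt0 e3 (mu_gt0 w)).
pose a v := if v \in s then f v else 0.
pose b v := if v \in s then 0 else f v.
have a0 v : 0 <= a v by rewrite /a; case: ifP.
have b0 v : 0 <= b v by rewrite /b; case: ifP.
have fE : f = a \+ b.
  by apply/funext => v; rewrite /= /a /b; case: ifP; rewrite ?addr0 ?add0r.
pose ca := \sum_(v <- s) mu v * f v.
have mean_a : mean a ca.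
  have -> : ca = \sum_(v <- s) mu v * a v.
    by apply: eq_big_seq => v vs; rewrite /a vs.
  apply: has_nnsum_seq => // v; first by rewrite mulr_ge0// ltW.
  by rewrite /a => /negbTE ->; rewrite mulr0.
have mean_b : mean b (c - ca).
  apply: (has_nnsumB mean_a) => [|v]; last by rewrite mulr_ge0// ltW.
  by move: fc; rewrite fE; apply: eq_has_nnsum => v /=; rewrite mulrDr.
have cb0 := has_nnsum_ge0 mean_b.
have aM v : 0 <= a v <= \sum_(x <- s) f x.
  rewrite a0 /a; case: ifP => vs; last by rewrite sumr_ge0.
  by rewrite (bigD1_seq v)//= lerDl sumr_ge0.
have a_cvg : iter n markov_op a w @[n --> \oo] --> ca.
  apply: (@bounded_synchronized_cvg (fun n => iter n markov_op a) ca _).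
  - move=> n v; rewrite iter_markov_op_ge0// iter_markov_op_le// => x.
    by have /andP[_] := aM x; exact.
  - by move=> n; exact: mean_iter_markov_op.
  - apply: (aperiodic_synchronization A0 aper) => i j /suppA.
    exact: markov_op_lag aM.
move/cvgrPdist_le: a_cvg => /(_ _ e3); apply: filterS => n a_near.
have b_small : iter n markov_op b w <= e / 3.
  have := has_nnsum_term w (mean_iter_markov_op n b0 mean_b) => /= bw.
  rewrite -(ler_pM2l (mu_gt0 w)) (le_trans bw)// mulrC.
  by rewrite -/ca in lt_s; lra.
have bn0 := iter_markov_op_ge0 n b0 w.
have c_small : c - ca <= e / 3.
  have : e / 3 * mu w <= e / 3 by rewrite ler_piMr// ltW.
  by rewrite -/ca in lt_s; lra.
rewrite fE iter_markov_opD /=; move: a_near; rewrite !ler_norml => /andP[? ?].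
by apply/andP; split; lra.
Qed.

End MarkovOperator.

(** * Path counts *)

Section Heights.
Context {V : countType} (F : V -> V -> nat).
Context (row_finite : forall v, finite_set [set w | F v w != 0%N]).
Implicit Types (u v w x : V) (n k : nat).

Definition sources v : seq V := enum_fset (fset_set [set w | F v w != 0%N]).

Lemma sources_uniq v : uniq (sources v).
Proof. exact: fset_uniq. Qed.

Lemma mem_sources v u : (u \in sources v) = (F v u != 0%N).
Proof.
rewrite /sources; apply/idP/idP => [|Fvu].
  by rewrite in_fset_set// inE.
by rewrite in_fset_set// inE.
Qed.

(** Walks are consumed from their first edge, whereas heights obey a recursion on
    the last edge. *)
Lemma is_walk_rcons x (es : seq (edge V)) u t k v :
  is_walk F x (rcons es (u, t, k)) v =
  [&& is_walk F x es u, (k < F t u)%N & t == v].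
Proof.
elim: es x => [|[[s1 t1] k1] es IH] x /=; first by rewrite eq_sym.
by rewrite IH -!andbA.
Qed.

(** A duplicate-free list of [finite_paths F n v]; the last edge of a path is
    coded by its source and its number among the parallel edges. *)
Fixpoint path_seq n v : seq (V * seq (edge V)) :=
  if n is m.+1 then
    [seq (p.1, rcons p.2 (a.1, v, a.2)) |
       a <- [seq (u, k) | u <- sources v, k <- iota 0 (F v u)],
       p <- path_seq m a.1]
  else [:: (v, [::])].

Lemma mem_path_seq n v p :
  (p \in path_seq n v) = (size p.2 == n) && is_walk F p.1 p.2 v.
Proof.
elim: n v p => [|n IH] v [x es].
  rewrite /= inE xpair_eqE andbC; case: es => //=.
apply/allpairsPdep/idP => [[[u k] [[y es'] []]]|].
  case/allpairsPdep => u' [k' [_ + [-> ->]]].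
  rewrite mem_iota add0n /= => ltk; rewrite IH/= => /andP[/eqP <- wlk] [-> ->].
  by rewrite size_rcons is_walk_rcons wlk ltk !eqxx.
case: (lastP es) => // {}es [[u t] k] /=.
rewrite size_rcons eqSS is_walk_rcons => /and4P[sz wlk ltk /eqP tv].
exists (u, k), (x, es); split => //=.
- apply/allpairsPdep; exists u, k; split => //.
    by rewrite mem_sources -lt0n -tv; exact: leq_ltn_trans ltk.
  by rewrite mem_iota add0n -tv.
- by rewrite IH sz.
- by rewrite tv.
Qed.

Lemma path_seq_uniq n v : uniq (path_seq n v).
Proof.
elim: n v => // n IH v; apply: allpairs_uniq_dep => [|a _|]; last 1 first.
- move=> [[u k] [x es]] [[u' k'] [x' es']] _ _ /= [-> /rcons_inj[-> -> ->]].
  by [].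
- apply: allpairs_uniq_dep => [|u _|]; [exact: sources_uniq|exact: iota_uniq|].
  by move=> [u k] [u' k'] _ _ /= [-> ->].
- exact: IH.
Qed.

Lemma height_path_seq n v : height F n v = size (path_seq n v).
Proof.
rewrite /height (_ : finite_paths F n v = [set` [fset p in path_seq n v]%fset]).
  by rewrite set_fsetK card_fseq undup_id// path_seq_uniq.
apply/seteqP; split=> p /=; rewrite inE mem_path_seq.
  by move=> [-> ->]; rewrite eqxx.
by move=> /andP[/eqP].
Qed.

Lemma height0 v : height F 0 v = 1%N.
Proof. by rewrite height_path_seq. Qed.

Lemma heightS n v :
  height F n.+1 v = (\sum_(u <- sources v) F v u * height F n u)%N.
Proof.
rewrite height_path_seq /= size_allpairs_dep sumnE big_map big_allpairs_dep.
apply: eq_bigr => u _; under eq_bigr do rewrite -height_path_seq/=.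
by rewrite big_const_seq count_predT size_iota iter_addn addn0 mulnC.
Qed.

End Heights.

(** * Growth of the heights *)

Section NormalizedHeights.
Context {R : realType} {V : countType} (F : V -> V -> nat).
Context (lam : R) (xi eta : V -> R).
Context (row_finite : forall v, finite_set [set w | F v w != 0%N])
  (col_nonzero : forall w, exists v, F v w != 0%N)
  (xi_gt0 : forall i, 0 < xi i)
  (eta_gt0 : forall i, 0 < eta i)
  (xi_eigen : right_eigenvector (tr_incidence R F) lam xi)
  (eta_eigen : left_eigenvector (tr_incidence R F) lam eta).

(** With [A] the transpose of [F], the kernel A i j * xi j / (lam * xi i) is
    stochastic with stationary weights eta i * xi i, and this is its time
    reversal. Unlike the forward kernel it has finite rows. *)
Definition reversed_chain (w u : V) : R :=
  (F w u)%:R * eta u / (lam * eta w).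

Lemma has_nnsum_xi u : has_nnsum (fun w => (F w u)%:R * xi w) (lam * xi u).
Proof. by split=> [w|]; [rewrite mulr_ge0// ltW|exact: xi_eigen]. Qed.

Lemma eigenvalue_gt0 (v : V) : 0 < lam.
Proof.
rewrite -(pmulr_lgt0 _ (xi_gt0 v)); have [w Fwv] := col_nonzero v.
apply: lt_le_trans (has_nnsum_term w (has_nnsum_xi v)).
by rewrite mulr_gt0// ltr0n lt0n.
Qed.

Lemma reversed_chain_gt0 w u : (0 < F w u)%N -> 0 < reversed_chain w u.
Proof.
move=> Fwu; rewrite !mulr_gt0 ?ltr0n// invr_gt0.
by rewrite mulr_gt0// (eigenvalue_gt0 w).
Qed.

Lemma reversed_chain_ge0 w u : 0 <= reversed_chain w u.
Proof.
have [F0|/reversed_chain_gt0/ltW//] := posnP (F w u).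
by rewrite /reversed_chain F0 !mul0r.
Qed.

Lemma reversed_chain_out w u : u \notin sources F w -> reversed_chain w u = 0.
Proof.
by rewrite mem_sources// negbK /reversed_chain => /eqP ->; rewrite !mul0r.
Qed.

Lemma reversed_chain_stoch w : \sum_(u <- sources F w) reversed_chain w u = 1.
Proof.
have le0 : lam * eta w != 0 by rewrite mulf_neq0 ?gt_eqF// (eigenvalue_gt0 w).
rewrite -mulr_suml -[RHS](divff le0); congr (_ / _); apply: EFin_inj.
rewrite -(eta_eigen w) -(@esum_finite_support _ _ _ _ (sources_uniq F w)).
- by apply: eq_esum => u _; rewrite mulrC.
- by move=> u; rewrite mulr_ge0// ltW.
- by move=> u; rewrite mem_sources// negbK => /eqP ->; rewrite mul0r.
Qed.

Lemma reversed_chain_stat u :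
  has_nnsum (fun w => eta w * xi w * reversed_chain w u) (eta u * xi u).
Proof.
have lam0 := eigenvalue_gt0 u.
have := has_nnsumZ (ltW (divr_gt0 (eta_gt0 u) lam0)) (has_nnsum_xi u).
rewrite mulrA divfK ?gt_eqF//; apply: eq_has_nnsum => w.
by rewrite /reversed_chain; field; rewrite !gt_eqF.
Qed.

(** The height recursion is [F] acting on column vectors; dividing by
    [lam ^+ n * eta] turns [F] into the reversed chain and the initial heights 1
    into the inverse of [eta]. *)
Lemma iter_reversed_chain n w :
  iter n (markov_op reversed_chain (sources F)) (fun v => (eta v)^-1) w =
  (height F n w)%:R / (lam ^+ n * eta w).
Proof.
have lam0 := eigenvalue_gt0 w.
elim: n w {lam0} => [|n IH] w.
  by rewrite height0// expr0 !mul1r.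
have lam0 := eigenvalue_gt0 w.
rewrite iterS heightS// natr_sum mulr_suml; apply: eq_bigr => u _.
by rewrite IH natrM exprS /reversed_chain; field; rewrite expf_neq0 ?gt_eqF.
Qed.

(** The mean of the inverse of [eta] for the weights eta v * xi v is the sum of
    [xi], that is 1, so the iterates of [iter_reversed_chain] tend to 1. *)
Theorem height_asymptotics :
  aperiodic_mx (tr_incidence R F) ->
  has_nnsum xi 1 -> has_nnsum (fun v => eta v * xi v) 1 ->
  forall w, (height F n w)%:R / lam ^+ n @[n --> \oo] --> eta w.
Proof.
move=> aper xi_sum mu_sum w.
have g_cvg := @markov_op_cvg _ _ reversed_chain (sources F) _
  (sources_uniq F) reversed_chain_ge0 reversed_chain_out reversed_chain_stoch
  (fun v => mulr_gt0 (eta_gt0 v) (xi_gt0 v)) mu_sum reversed_chain_stat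
  (tr_incidence R F) (fun v => (eta v)^-1) 1.
have : iter n (markov_op reversed_chain (sources F))
    (fun v => (eta v)^-1) w @[n --> \oo] --> (1 : R).
  apply: g_cvg => //.
  - by move=> i j; rewrite ltr0n; exact: reversed_chain_gt0.
  - by move=> v; rewrite invr_ge0 ltW.
  - move: xi_sum; apply: eq_has_nnsum => v.
    by rewrite mulrC mulrA mulVf ?mul1r// gt_eqF.
move=> h1; rewrite -[eta w]mul1r.
have E n : (height F n w)%:R / lam ^+ n =
    iter n (markov_op reversed_chain (sources F))
      (fun v => (eta v)^-1) w * eta w.
  rewrite iter_reversed_chain; field.
  by rewrite expf_neq0 ?gt_eqF ?(eigenvalue_gt0 w).
by under eq_fun do rewrite E; apply: cvgMr_tmp.
Qed.

End NormalizedHeights.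
Theorem theorem8p7 (R : realType) (V : countType) (F : V -> V -> nat)
    (lam : R) (xi eta : V -> R)
    (hF : stationary_bratteli F)
    (hirr : irreducible_mx (tr_incidence R F))
    (haper : aperiodic_mx (tr_incidence R F))
    (hlam : perron_eigenvalue (tr_incidence R F) lam)
    (hrec : positive_recurrent_mx (tr_incidence R F) lam)
    (hxi_gt0 : forall i, 0 < xi i)
    (heta_gt0 : forall i, 0 < eta i)
    (hxi : right_eigenvector (tr_incidence R F) lam xi)
    (heta : left_eigenvector (tr_incidence R F) lam eta)
    (hxi_sum : (\esum_(v in [set: V]) (xi v)%:E = 1)%E)
    (hetaxi_sum : (\esum_(v in [set: V]) (eta v * xi v)%:E = 1)%E)
    (v w : V) :
  ((height F n w)%:R / (height F n.+1 v)%:R : R) @[n --> \oo]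
    --> eta w / (lam * eta v).
Proof.
have [_ row_finite _ col_nonzero] := hF.
have lam0 : 0 < lam by exact: (eigenvalue_gt0 col_nonzero hxi_gt0 hxi v).
have asym x : (height F n x)%:R / lam ^+ n @[n --> \oo] --> eta x.
  apply: (height_asymptotics row_finite col_nonzero hxi_gt0 heta_gt0
    hxi heta) => //.
    by split=> // i; rewrite ltW.
  by split=> // i; rewrite mulr_ge0// ltW.
(* Only lam ^+ n is divided out at level n.+1, which leaves a factor lam. *)
have asymS : (height F n.+1 v)%:R / lam ^+ n @[n --> \oo] --> lam * eta v.
  have := asym v.
  rewrite -(cvg_shiftS (fun n => (height F n v)%:R / lam ^+ n)) => h.
  have E n : (height F n.+1 v)%:R / lam ^+ n =
      lam * ((height F n.+1 v)%:R / lam ^+ n.+1).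
    by rewrite exprS; field; rewrite expf_neq0 gt_eqF.
  by under eq_fun do rewrite E; apply: cvgMl_tmp.
have E n : (height F n w)%:R / (height F n.+1 v)%:R =
    ((height F n w)%:R / lam ^+ n) / ((height F n.+1 v)%:R / lam ^+ n) :> R.
  by rewrite invf_div mulrA divfK// expf_neq0// gt_eqF.
under eq_fun do rewrite E.
by apply: cvgM; [exact: asym|apply: cvgV; rewrite ?mulf_neq0 ?gt_eqF].
Qed.
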